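(* Let $m\ge 2$ be the number of registers of a HyperLogLog sketch into which $n$ distinct elements have been inserted, and suppose $n>4m\log_2 m$. Let $B=\log_2\frac{n}{m}$ and $\Delta=2+\log_2\log_2 m$. Then with probability at least $1-\exp\!\left(-\frac{m}{6\log_2 m}\right)$, at least $m-\frac{m}{\log_2 m}$ of the register values $M[j]$ lie in $(B-\Delta,B+\Delta)$, and hence can be represented as offsets from the base value $B$ using at most $\lceil\log_2(2+\log_2\log_2 m)\rceil+1=\log\log\log m+O(1)$ bits each.
   Context: HyperLogLog model: each of $n$ distinct elements $y_i$ is assigned a register index $f(y_i)$ uniform in $[m]=\{1,\dots,m\}$ and a value $\rho_i$ with $\Pr[\rho_i=k]=2^{-k}$, $k=1,2,\dots$ (the position of the first one-bit of a uniformly random hash value), all independent; register $M[j]$ is the maximum of $\rho_i$ over elements with $f(y_i)=j$ (0 if none), so $\Pr[M[j]\le k]=(1-\frac{1}{m2^k})^n$ for integers $k\ge0$. Convention: register values are treated as real-valued continuous random variables whose individual distribution function is $\Pr[M[j]\le t]=\Pr[M[j]<t]=(1-\frac{1}{m2^t})^n$ for real $t$. All logarithms are base 2. *)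

(* Defs.v *)
From HB Require Import structures.
From mathcomp Require Import all_boot all_order all_algebra.
From mathcomp Require Import all_classical all_reals all_analysis.
Set Implicit Arguments. Unset Strict Implicit. Unset Printing Implicit Defensive.
Import Order.TTheory GRing.Theory Num.Theory.
Local Open Scope classical_set_scope.
Local Open Scope ring_scope.

Definition log2 {R : realType} (x : R) : R := ln x / ln 2.

Section HLL.
Context {R : realType} {d : measure_display} {T : measurableType d}.

(* Mutual independence of the 2n random variables f_0..f_{n-1}, rho_0..rho_{n-1}:
   the product rule for every choice of (measurable) events, one per variable
   (choosing the whole space for some variables gives every subfamily). *)
Definition hll_indep (P : probability T R) (n m : nat)
  (f : 'I_n -> T -> 'I_m) (rho : 'I_n -> T -> R) : Prop :=
  forall (A : 'I_n -> {set 'I_m}) (C : 'I_n -> set R),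
    (forall i, measurable (C i)) ->
    fine (P (\bigcap_(i in [set: 'I_n])
               ([set w | f i w \in A i] `&` (rho i @^-1` C i))))
    = \prod_(i < n) (fine (P [set w | f i w \in A i]) * fine (P (rho i @^-1` C i))).

Definition hll_register (n m : nat) (f : 'I_n -> T -> 'I_m) (rho : 'I_n -> T -> R)
  (j : 'I_m) (w : T) : R :=
  \big[Num.max/0]_(i < n | f i w == j) rho i w.

End HLL.

(* Main.v *)
(** Put [L = log2 m], [lo = B - Delta] and [hi = B + Delta]. A register with value
    outside [(lo, hi)] either received no element with [rho > lo], or received an
    element with [rho >= hi]. Let [Y] be the number of registers of the first kind
    and [N] the number of elements with [rho >= hi]. The registers are dependent,
    but [2 ^ Y] is the sum over all sets [S] of registers of the indicator that every
    register of [S] is of the first kind, and both this indicator and [2 ^ N] are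
    products over the independent elements. Hence
    [E 2 ^ (Y + N) <= (1 + exp (- 4 L)) ^ m * exp (n * Pr (rho >= hi))],
    and Markov's inequality at [Y + N > m / L] gives the bound. *)
Require Import Defs.
From HB Require Import structures.
From mathcomp Require Import all_boot all_order all_algebra.
From mathcomp Require Import all_classical all_reals all_analysis.
From mathcomp Require Import ring lra zify.
Import Order.TTheory GRing.Theory Num.Theory.
Local Open Scope classical_set_scope.
Local Open Scope ring_scope.

(** * Base-2 logarithms, numerical constants and integer counting *)

Lemma powR_log2 (R : realType) (x : R) : 0 < x -> 2 `^ (log2 x) = x.
Proof.
move=> x0; have l2 : 0 < ln (2 : R) by rewrite ln_gt0 // ltr1n.
by rewrite /powR pnatr_eq0 /= /log2 divfK ?lnK ?posrE // gt_eqF.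
Qed.

Lemma log2_powR2 (R : realType) (x : R) : log2 (2 `^ x) = x.
Proof. by rewrite /log2 ln_powR mulfK // gt_eqF // ln_gt0 // ltr1n. Qed.

Lemma ler_log2 (R : realType) (x y : R) : 0 < x -> x <= y -> log2 x <= log2 y.
Proof.
move=> x0 xy; have l2 : 0 < ln (2 : R) by rewrite ln_gt0 // ltr1n.
by rewrite /log2 ler_pM2r ?invr_gt0 // ler_ln ?posrE // (lt_le_trans x0).
Qed.

Lemma log2_2 (R : realType) : log2 (2 : R) = 1.
Proof. by rewrite /log2 divff // gt_eqF // ln_gt0 // ltr1n. Qed.

Lemma log2_ge0 (R : realType) (x : R) : 1 <= x -> 0 <= log2 x.
Proof. by move=> x1; rewrite /log2 divr_ge0 ?ln_ge0 ?ler1n. Qed.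

(** [expR (3 / 5) <= 2], because [expR (- (1 / 5)) >= 4 / 5] and [(4 / 5) ^ 3 = 0.512]. *)
Lemma ln2_ge (R : realType) : 3 / 5 <= ln (2 : R).
Proof.
have h : (4 / 5 : R) <= expR (- (1 / 5)).
  by apply: le_trans (expR_ge1Dx _); lra.
have h3 : (1 / 2 : R) <= expR (- (3 / 5)).
  have -> : - (3 / 5) = 3%:R * - (1 / 5) :> R by lra.
  rewrite expRM_natl; apply: le_trans (lerXn2r 3 _ _ h); rewrite ?nnegrE ?expR_ge0 //; lra.
rewrite -[X in X <= _]expRK ler_ln ?posrE ?expR_gt0 //.
rewrite expRN in h3; have e0 := expR_gt0 (3 / 5 : R).
rewrite -[X in X <= _]invrK invf_ple ?posrE ?invr_gt0 //; lra.
Qed.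

Lemma mul_expRN4_le (R : realType) (x : R) : 1 <= x -> x * expR (- (4 * x)) <= 1 / 16.
Proof.
move=> x1; rewrite expRN ler_pdivrMr ?expR_gt0 //.
have h : 1 + x <= expR x by exact: expR_ge1Dx.
have h4 : (1 + x) ^+ 4 <= expR (4 * x).
  by rewrite expRM_natl lerXn2r // ?nnegrE ?expR_ge0 //; lra.
suff : x * 16 <= (1 + x) ^+ 4 by lra.
have : 0 <= (1 + x) ^+ 4 - x * 16.
  (* The polynomial inequality is an equality at [x = 1], hence the factor [x - 1]. *)
  have -> : (1 + x) ^+ 4 - x * 16 = (x - 1) * (x ^+ 3 + 5 * x ^+ 2 + 10 * x + (x - 1)) by ring.
  have x0 : 0 <= x by lra.
  apply: mulr_ge0; first lra.
  apply: addr_ge0; last lra.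
  by rewrite !addr_ge0 ?mulr_ge0 ?exprn_ge0.
by rewrite subr_ge0.
Qed.

Lemma sqrt2_le (R : realType) : Num.sqrt (2 : R) <= 71 / 50.
Proof.
rewrite -(@ger0_norm _ (71 / 50 : R)); last lra.
rewrite -sqrtr_sqr ler_sqrt; rewrite ?expr2; lra.
Qed.

(** Subtracting [Num.floor x + 1] maps these integers injectively into [[0, N)]. *)
Lemma size_int_itv (R : realType) (x y : R) (N : nat) (s : seq int) :
  y <= x + N%:R -> uniq s ->
  all (fun k : int => (x < k%:~R) && (k%:~R < y)) s -> (size s <= N)%N.
Proof.
move=> xyN us /allP sxy.
have inj : {in s &, injective (fun k : int => absz (k - Num.floor x - 1)%R)}.
  move=> k l /sxy /andP[xk _] /sxy /andP[xl _].
  have aux (z u v : int) : z < u -> z < v ->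
    absz (u - z - 1)%R = absz (v - z - 1)%R -> u = v by lia.
  by apply: aux; rewrite floor_lt_int.
rewrite -(size_map (fun k : int => absz (k - Num.floor x - 1)%R)) -(size_iota 0 N).
apply: uniq_leq_size; first by rewrite map_inj_in_uniq.
move=> _ /mapP[k /sxy /andP[xk ky] ->]; rewrite mem_iota add0n.
have : k%:~R < (Num.floor x + 1 + N%:Z)%:~R :> R.
  rewrite intrD; have := floorD1_gt x; rewrite -pmulrn; lra.
have aux (z u N' : int) : z < u -> u < z + 1 + N' -> (absz (u - z - 1)%R < `|N'|)%N by lia.
by rewrite -floor_lt_int in xk; rewrite ltr_int => /(aux _ _ _ xk).
Qed.

(** * Laws of finite-valued maps *)

Lemma measurable_mem_itv_eq (R : realType) (I : interval R) (b : bool) :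
  measurable [set r : R | (r \in I) = b].
Proof.
case: b; first exact: measurable_itv.
rewrite (_ : [set r | _] = ~` [set` I]); first by apply: measurableC; exact: measurable_itv.
by apply/seteqP; split => r /=; [move=> -> | move/negP/negbTE].
Qed.

Lemma prob_finite_valued (R : realType) d (T : measurableType d) (P : probability T R)
  (X : finType) (g : T -> X) (Q : pred X) :
  (forall x, measurable [set w | g w = x]) ->
  measurable [set w | Q (g w)] /\
  P [set w | Q (g w)] = (\sum_(x | Q x) fine (P [set w | g w = x]))%:E.
Proof.
move=> mg.
have QE : [set w | Q (g w)] = \bigcup_(x in [set x | Q x]) [set w | g w = x].
  apply/seteqP; split => [w /= Qw|w /= [x Qx /= ->] //].
  by exists (g w).
have finQ : finite_set [set x | Q x] by [].
split; first by rewrite QE; apply: fin_bigcup_measurable.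
rewrite QE measure_fin_bigcup //; last by move=> x y _ _ [w [/= <- <-]].
rewrite -sumEFin -(bigfs _ (index_enum_uniq _)) /=; last first.
  by move=> x; rewrite mem_index_enum.
by apply: eq_bigr => x _; rewrite fineK // fin_num_measure.
Qed.

(** An event that depends only on the values of the [g i] is a finite disjoint union of joint
    fibres, whose weights are products. *)
Lemma prob_finite_joint (R : realType) d (T : measurableType d) (P : probability T R)
  (X : finType) (n : nat) (g : 'I_n -> T -> X) (p : 'I_n -> X -> R)
  (Q : pred {ffun 'I_n -> X}) :
  (forall i x, measurable [set w | g i w = x]) ->
  (forall x : {ffun 'I_n -> X},
    fine (P (\bigcap_(i in [set: 'I_n]) [set w | g i w = x i])) = \prod_i p i (x i)) ->
  measurable [set w | Q [ffun i => g i w]] /\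
  P [set w | Q [ffun i => g i w]] = (\sum_(x | Q x) \prod_i p i (x i))%:E.
Proof.
move=> mg Pg.
have fibE (x : {ffun 'I_n -> X}) : [set w | [ffun i => g i w] = x] =
    \bigcap_(i in [set: 'I_n]) [set w | g i w = x i].
  apply/seteqP; split => [w /= <- i _ /=|w /= gx]; first by rewrite ffunE.
  by apply/ffunP => i; rewrite ffunE; exact: gx.
have mfib (x : {ffun 'I_n -> X}) : measurable [set w | [ffun i => g i w] = x].
  by rewrite fibE; apply: fin_bigcap_measurable.
have [mQ ->] := prob_finite_valued _ _ _ P _ _ Q mfib.
by split=> //; congr EFin; apply: eq_bigr => x _; rewrite fibE Pg.
Qed.

(** * Exponential moments over configurations *)

Lemma sum_exprn_card (R : realType) (m : nat) (z : R) :
  \sum_(S : {set 'I_m}) z ^+ #|S| = (1 + z) ^+ m.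
Proof.
rewrite addrC -[in RHS](card_ord m) -prodr_const bigA_distr; apply: eq_bigr => S _.
by rewrite -big_mkcond /= prodr_const.
Qed.

(* A configuration [x] records, for each element [i], its register [(x i).1], the
   truth value [(x i).2.1] of [lo < rho i] and the one [(x i).2.2] of
   [hi <= rho i]; the impossible value [(false, true)] simply has weight 0. *)
Definition untouched {n m : nat} (x : {ffun 'I_n -> 'I_m * (bool * bool)}) :=
  [set j | [forall i, ((x i).1 == j) ==> ~~ (x i).2.1]]%SET.

Definition high {n m : nat} (x : {ffun 'I_n -> 'I_m * (bool * bool)}) :=
  [set i | (x i).2.2]%SET.

Definition centered {n m : nat} (x : {ffun 'I_n -> 'I_m * (bool * bool)}) :=
  [set j | [exists i, ((x i).1 == j) && (x i).2.1]
           && [forall i, ((x i).1 == j) ==> ~~ (x i).2.2]]%SET.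

(* [2 ^ #|A|] counts the subsets of [A]; for each fixed subset [S] of registers,
   being untouched on [S] is a product condition over the elements. *)
Lemma exp2_untouched (R : realType) (n m : nat) (x : {ffun 'I_n -> 'I_m * (bool * bool)}) :
  2 ^+ #|untouched x| = \sum_(S : {set 'I_m}) \prod_i (~~ (((x i).1 \in S) && (x i).2.1))%:R :> R.
Proof.
rewrite -natrX -card_powerset -sum1_card natr_sum big_mkcond /=.
apply: eq_bigr => S _; rewrite powersetE; case: ifPn => [/fintype.subsetP sub|].
  rewrite big1 // => i _; case: andP => // -[/sub]; rewrite inE => /forallP/(_ i).
  by rewrite eqxx /= => /negbTE ->.
case/fintype.subsetPn => j jS; rewrite inE negb_forall => /existsP[i].
rewrite negb_imply negbK => /andP[/eqP ij xi].
by rewrite (bigD1 i) //= ij jS xi mul0r.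
Qed.

Lemma exp2_high (R : realType) (n m : nat) (x : {ffun 'I_n -> 'I_m * (bool * bool)}) :
  2 ^+ #|high x| = \prod_i (1 + (x i).2.2%:R) :> R.
Proof.
rewrite -prodr_const big_mkcond /=; apply: eq_bigr => i _.
by rewrite inE; case: ifP => _; rewrite ?addr0.
Qed.

(** With [S] fixed, one element contributes at most [1 + b - #|S| * (a / m)]; then
    [1 + u <= expR u]. *)
Lemma exp_moment_factor (R : realType) (m : nat) (q : bool * bool -> R) (a b : R)
  (S : {set 'I_m}) :
  (0 < m)%N -> (forall c, 0 <= q c) -> \sum_c q c = 1 ->
  \sum_(c | c.1) q c = a -> \sum_(c | c.2) q c <= b ->
  \sum_(y : 'I_m * (bool * bool))
     m%:R^-1 * q y.2 * ((~~ ((y.1 \in S) && y.2.1))%:R * (1 + y.2.2%:R))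
  <= expR (b - #|S|%:R * (a / m%:R)).
Proof.
move=> m0 q0 q1 qa qb; apply: le_trans (expR_ge1Dx _).
have m0R : (m%:R : R) != 0 by rewrite pnatr_eq0 -lt0n.
have row (j : 'I_m) :
    \sum_(c : bool * bool) m%:R^-1 * q c * ((~~ ((j \in S) && c.1))%:R * (1 + c.2%:R))
    <= m%:R^-1 * (1 + b - (j \in S)%:R * a).
  under eq_bigr do rewrite -mulrA; rewrite -mulr_sumr ler_wpM2l ?invr_ge0 //.
  (* Expanding the product leaves a cross term in [c.1] and [c.2], which is nonpositive and is
     dropped. *)
  apply: (@le_trans _ _ (\sum_c q c + \sum_(c | c.2) q c
                         - (j \in S)%:R * \sum_(c | c.1) q c)); last first.
    by rewrite q1 qa lerD2r lerD2l.
  rewrite (big_mkcond (fun c => c.1)) (big_mkcond (fun c => c.2)) /=.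
  rewrite mulr_sumr -big_split /= -sumrB ler_sum // => -[c1 c2] _ /=.
  have := q0 (c1, c2); case: (j \in S); case: c1; case: c2 => /=; lra.
rewrite -(pair_bigA _ (fun j c => m%:R^-1 * q c *
  ((~~ ((j \in S) && c.1))%:R * (1 + c.2%:R)))) /=.
apply: le_trans (ler_sum _ (fun j _ => row j)) _.
have cardS : \sum_(j < m) (j \in S)%:R = #|S|%:R :> R.
  by rewrite -sum1_card natr_sum [RHS]big_mkcond; apply: eq_bigr => j _; case: (j \in S).
rewrite -mulr_sumr sumrB sumr_const card_ord -mulr_suml cardS -mulr_natr.
by rewrite le_eqVlt; apply/orP; left; apply/eqP; field.
Qed.

Lemma exp_moment_le (R : realType) (n m : nat) (q : 'I_n -> bool * bool -> R) (a b : R) :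
  (0 < m)%N -> (forall i c, 0 <= q i c) -> (forall i, \sum_c q i c = 1) ->
  (forall i, \sum_(c | c.1) q i c = a) -> (forall i, \sum_(c | c.2) q i c <= b) ->
  \sum_(x : {ffun 'I_n -> 'I_m * (bool * bool)})
     (\prod_i (m%:R^-1 * q i (x i).2)) * 2 ^+ (#|untouched x| + #|high x|)
  <= expR (n%:R * b + m%:R * expR (- (n%:R * a / m%:R))).
Proof.
move=> m0 q0 q1 qa qb.
have E (x : {ffun 'I_n -> 'I_m * (bool * bool)}) :
    (\prod_i (m%:R^-1 * q i (x i).2)) * 2 ^+ (#|untouched x| + #|high x|) =
    \sum_(S : {set 'I_m}) \prod_i (m%:R^-1 * q i (x i).2 *
      ((~~ (((x i).1 \in S) && (x i).2.1))%:R * (1 + (x i).2.2%:R))).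
  rewrite exprD exp2_untouched exp2_high mulr_suml mulr_sumr.
  by apply: eq_bigr => S _; rewrite -!big_split.
under eq_bigr do rewrite E.
rewrite exchange_big /= expRD.
apply: (@le_trans _ _ (\sum_(S : {set 'I_m})
    expR (n%:R * b) * expR (- (n%:R * a / m%:R)) ^+ #|S|)).
  apply: ler_sum => S _.
  (* Distributivity turns the sum over configurations into a product of one sum per element. *)
  rewrite -(bigA_distr_bigA (fun i y => m%:R^-1 * q i y.2 *
    ((~~ ((y.1 \in S) && y.2.1))%:R * (1 + y.2.2%:R)))) /=.
  rewrite -expRM_natl -expRD.
  have -> : n%:R * b + #|S|%:R * - (n%:R * a / m%:R) =
            n%:R * (b - #|S|%:R * (a / m%:R)) by ring.
  rewrite expRM_natl -[in X in _ <= X](card_ord n) -prodr_const.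
  apply: ler_prod => i _; apply/andP; split.
    by apply: sumr_ge0 => y _; rewrite !mulr_ge0 ?invr_ge0 ?addr_ge0.
  exact: exp_moment_factor.
(* Summing [z ^ #|S|] over [S] gives [(1 + z) ^ m <= expR (m * z)]. *)
rewrite -mulr_sumr ler_pM2l ?expR_gt0 // sum_exprn_card expRM_natl.
by rewrite lerXn2r ?nnegrE ?addr_ge0 ?expR_ge0 ?expR_ge1Dx.
Qed.

(** A register that is not centered is untouched or holds a high element, and each high element
    spoils only its own register. *)
Lemma card_centered (n m : nat) (x : {ffun 'I_n -> 'I_m * (bool * bool)}) :
  (m <= #|centered x| + (#|untouched x| + #|high x|))%N.
Proof.
rewrite -[X in (X <= _)%N](card_ord m) -(cardsC (centered x)) leq_add2l.
apply: leq_trans (leq_add (leqnn _) (leq_imset_card (fun i => (x i).1) (mem (high x)))).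
apply: leq_trans (leq_card_setU _ _); apply: subset_leq_card.
apply/fintype.subsetP => j; rewrite !inE negb_and negb_exists negb_forall.
case/orP => [/forallP h|/existsP[i]].
  by apply/orP; left; apply/forallP => i; have := h i; rewrite negb_and implybE.
rewrite negb_imply negbK => /andP[/eqP ij xi]; apply/orP; right.
by apply/imsetP; exists i; rewrite ?inE.
Qed.

(** * Centered registers and their tail bound *)

(** The default [0] of the maximum is not above [lo], and it is below [hi], so only the elements
    decide both comparisons. *)
Lemma hll_register_centered (R : realType) d (T : measurableType d) (n m : nat)
  (f : 'I_n -> T -> 'I_m) (rho : 'I_n -> T -> R) (lo hi : R) (w : T) :
  0 <= lo -> 0 < hi ->
  [set j | (lo < hll_register f rho j w) && (hll_register f rho j w < hi)]%SET =
  centered [ffun i => (f i w, (lo < rho i w, hi <= rho i w))].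
Proof.
move=> lo0 hi0; apply/setP => j; rewrite !inE; congr (_ && _).
  apply/bigmax_gtP/existsP => [[|[i fi ri]]|[i]].
  - by rewrite ltNge lo0.
  - by exists i; rewrite ffunE /= fi.
  - by rewrite ffunE /= => /andP[fi ri]; right; exists i.
apply/bigmax_ltP/forallP => [[_ h] i|h].
  by rewrite ffunE /= -ltNge; apply/implyP => /h.
by split=> // i fi; have := h i; rewrite ffunE /= fi /= -ltNge.
Qed.

(** Markov's inequality: with fewer than [m - t] centered registers, [card_centered] forces
    [#|untouched x| + #|high x| > t]. *)
Lemma exp_moment_tail (R : realType) (n m : nat) (q : 'I_n -> bool * bool -> R) (a b t : R) :
  (0 < m)%N -> (forall i c, 0 <= q i c) -> (forall i, \sum_c q i c = 1) ->
  (forall i, \sum_(c | c.1) q i c = a) -> (forall i, \sum_(c | c.2) q i c <= b) ->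
  \sum_(x : {ffun 'I_n -> 'I_m * (bool * bool)} | ~~ (m%:R - t <= #|centered x|%:R))
     \prod_i (m%:R^-1 * q i (x i).2)
  <= expR (n%:R * b + m%:R * expR (- (n%:R * a / m%:R))) * 2 `^ (- t).
Proof.
move=> m0 q0 q1 qa qb.
apply: le_trans (ler_wpM2r (powR_ge0 _ _) (exp_moment_le _ _ _ q _ _ m0 q0 q1 qa qb)).
have W0 (x : {ffun 'I_n -> 'I_m * (bool * bool)}) : 0 <= \prod_i (m%:R^-1 * q i (x i).2).
  by apply: prodr_ge0 => i _; rewrite mulr_ge0.
rewrite mulr_suml big_mkcond /=; apply: ler_sum => x _.
case: ifPn => [|_]; last by rewrite !mulr_ge0 ?powR_ge0 ?exprn_ge0.
rewrite -ltNge => few; rewrite -mulrA ler_peMr //.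
rewrite -powR_mulrn // -powRD ?pnatr_eq0 ?implybT //.
rewrite -[X in X <= _](@powRr0 _ 2) ler_powR ?ler1n // subr_ge0.
have := card_centered _ _ x; rewrite -(ler_nat R) natrD; lra.
Qed.

Lemma prob_hll_register_centered (R : realType) d (T : measurableType d)
  (P : probability T R) (m n : nat) (f : 'I_n -> T -> 'I_m) (rho : 'I_n -> T -> R)
  (lo hi a b t : R) :
  (0 < m)%N ->
  (forall i k, measurable [set w | f i w = k]) ->
  (forall i k, P [set w | f i w = k] = (m%:R^-1)%:E) ->
  (forall i, measurable_fun setT (rho i)) ->
  hll_indep P f rho ->
  0 <= lo -> 0 < hi ->
  (forall i, P [set w | lo < rho i w] = a%:E) ->
  (forall i, (P [set w | (hi <= rho i w)%R] <= b%:E)%E) ->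
  ((1 - expR (n%:R * b + m%:R * expR (- (n%:R * a / m%:R))) * 2 `^ (- t))%:E
   <= P [set w | (m%:R - t <= #|[set j | (lo < hll_register f rho j w)
                                   && (hll_register f rho j w < hi)]%SET|%:R)%R])%E.
Proof.
move=> m0 mf Pf mrho ind lo0 hi0 Pa Pb.
(* Two bits of each [rho i] decide the event, which reduces its law to four weights. *)
pose C (c : bool * bool) : set R := [set r | (lo < r, hi <= r) = c].
have mC c : measurable (C c).
  have -> : C c = [set r : R | (r \in `]lo, +oo[) = c.1] `&`
                  [set r : R | (r \in `[hi, +oo[) = c.2].
    apply/seteqP; split => r; rewrite /C /= !in_itv /= !andbT; first by move=> <-.
    by case: c => u v [/= -> ->].
  by apply: measurableI; exact: measurable_mem_itv_eq.
have mrhoC i c : measurable (rho i @^-1` C c).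
  by rewrite -[X in measurable X]setTI; exact: mrho.
pose q (i : 'I_n) c := fine (P (rho i @^-1` C c)).
have qE i (Q : pred (bool * bool)) :
    P [set w | Q (lo < rho i w, hi <= rho i w)] = (\sum_(c | Q c) q i c)%:E.
  by have [] := prob_finite_valued _ _ _ P _ (fun w => (lo < rho i w, hi <= rho i w)) Q (mrhoC i).
have q0 i c : 0 <= q i c by rewrite fine_ge0.
have q1 i : \sum_c q i c = 1.
  have := qE i predT.
  by rewrite (_ : [set w | _] = setT) ?probability_setT => [[]|]; last exact/seteqP.
have qa i : \sum_(c | c.1) q i c = a.
  by have := qE i (fun c => c.1); rewrite /= Pa => -[].
have qb i : \sum_(c | c.2) q i c <= b.
  by rewrite -lee_fin -(qE i (fun c => c.2)); exact: Pb.
pose g i w := (f i w, (lo < rho i w, hi <= rho i w)).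
pose p i (y : 'I_m * (bool * bool)) := m%:R^-1 * q i y.2.
have gE y i : [set w | g i w = y] = [set w | f i w = y.1] `&` rho i @^-1` C y.2.
  by apply/seteqP; split => w; case: y => j c; rewrite /g /C /= => -[-> ->].
have mg i y : measurable [set w | g i w = y].
  by rewrite gE; apply: measurableI.
have Pg (x : {ffun 'I_n -> 'I_m * (bool * bool)}) :
    fine (P (\bigcap_(i in [set: 'I_n]) [set w | g i w = x i])) = \prod_i p i (x i).
  (* The product rule is taken at singleton register events and the fibres [C]. *)
  have /= := ind (fun i => [set (x i).1]%SET) (fun i => C (x i).2) (fun i => mC _).
  have fE i : [set w | f i w \in [set (x i).1]%SET] = [set w | f i w = (x i).1].
    by apply/seteqP; split => w /=; rewrite inE => /eqP.
  under eq_bigr do rewrite fE Pf /=.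
  move=> <-; congr (fine (P _)); apply: eq_bigcapr => i _.
  by rewrite gE -fE.
pose Q (x : {ffun 'I_n -> 'I_m * (bool * bool)}) := m%:R - t <= #|centered x|%:R :> R.
rewrite (_ : [set w | _] = [set w | Q [ffun i => g i w]]); last first.
  by apply/seteqP; split => w /=; rewrite hll_register_centered.
have [_ ->] := prob_finite_joint _ _ _ P _ _ g p Q mg Pg.
have [_] := prob_finite_joint _ _ _ P _ _ g p predT mg Pg.
rewrite (_ : [set w | _] = setT) ?probability_setT; last exact/seteqP.
(* The total weight is 1, so it remains to bound the weight of the complement of [Q]. *)
move=> [tot]; rewrite lee_fin {1}tot (bigID Q) /= lerBlDr lerD2l.
exact: exp_moment_tail.
Qed.

(** * Constants, encoding size and the conclusion *)

(* The event [hi <= rho] is enlarged to [hi - 1/2 < rho] so that the tail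
   hypothesis applies; the lost factor [sqrt 2] is absorbed by the slack in the
   constants. *)
Lemma prob_ge_le_sqrt2 (R : realType) d (T : measurableType d) (P : probability T R)
  (X : T -> R) (t : R) :
  measurable_fun setT X ->
  (forall s, 0 <= s -> P [set w | s < X w] = (2 `^ (- s))%:E) ->
  1 / 2 <= t ->
  (P [set w | (t <= X w)%R] <= (Num.sqrt 2 * 2 `^ (- t))%:E)%E.
Proof.
move=> mX PX t2.
have -> : Num.sqrt 2 * 2 `^ (- t) = 2 `^ (- (t - 1 / 2)) :> R.
  by rewrite opprB powRD ?pnatr_eq0 ?implybT // div1r powR12_sqrt.
rewrite -PX; last lra.
apply: le_measure; rewrite ?inE /=; last by move=> w /=; lra.
- have -> : [set w | t <= X w] = setT `&` X @^-1` `[t, +oo[.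
    by apply/seteqP; split => w /=; rewrite in_itv /= andbT //; case.
  by apply: mX => //; exact: measurable_itv.
- have -> : [set w | t - 1 / 2 < X w] = setT `&` X @^-1` `]t - 1 / 2, +oo[.
    by apply/seteqP; split => w /=; rewrite in_itv /= andbT //; case.
  by apply: mX => //; exact: measurable_itv.
Qed.

(** The interval has length [2 * D], at most the stated power of 2; [1 <= D] makes the exponent
    positive, so this power is a natural number. *)
Lemma size_int_centered_itv (R : realType) (b D : R) (s : seq int) :
  1 <= D -> uniq s ->
  all (fun k : int => (b - D < k%:~R) && (k%:~R < b + D)) s ->
  (size s)%:R <= (2 : R) ^ (Num.ceil (log2 D) + 1).
Proof.
move=> D1 us sb.
have [N -> DN] : exists2 N : nat,
    (2 : R) ^ (Num.ceil (log2 D) + 1) = N%:R & 2 * D <= N%:R.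
  have c0 : 0 <= Num.ceil (log2 D).
    by rewrite ceil_ge0 (lt_le_trans _ (log2_ge0 _ _ D1)) //; lra.
  case: (Num.ceil (log2 D)) c0 (ceil_ge (log2 D)) => // k _ hk.
  exists (2 ^ k.+1)%N; first by rewrite natrX -PoszD addn1.
  rewrite natrX exprS ler_pM2l // -(@powR_log2 _ D); last lra.
  by rewrite -powR_mulrn // ler_powR // ler1n.
by rewrite ler_nat; apply: size_int_itv us sb; lra.
Qed.

(* The exponent is [m/L * (sqrt 2 / 4 + L e^(-4L) - ln 2)], and
   [1.42 / 4 + 1/16 - 3/5 < - 1/6]. *)
Lemma hll_tail_exponent (R : realType) (m L : R) :
  0 < m -> 1 <= L ->
  expR (m * Num.sqrt 2 / (4 * L) + m * expR (- (4 * L))) * 2 `^ (- (m / L))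
  <= expR (- (m / (6 * L))).
Proof.
move=> m0 L1; have L0 : 0 < L by lra.
rewrite /powR pnatr_eq0 /= -expRD ler_expR.
have -> : m * Num.sqrt 2 / (4 * L) + m * expR (- (4 * L)) + - (m / L) * ln 2 =
    m / L * (Num.sqrt 2 / 4 + L * expR (- (4 * L)) - ln 2).
  by field; rewrite gt_eqF.
have -> : - (m / (6 * L)) = m / L * - (1 / 6) by field; rewrite gt_eqF.
rewrite ler_pM2l ?divr_gt0 //.
have := mul_expRN4_le _ _ L1; have := sqrt2_le R; have := ln2_ge R; lra.
Qed.

Theorem theorem3p5 (R : realType) (d : measure_display) (T : measurableType d)
  (P : probability T R) (m n : nat)
  (f : 'I_n -> T -> 'I_m) (rho : 'I_n -> T -> R) :
  (2 <= m)%N ->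
  4 * m%:R * log2 (m%:R : R) < n%:R ->
  (* f_i : uniform register index in [m] *)
  (forall i k, measurable [set w | f i w = k]) ->
  (forall i k, P [set w | f i w = k] = (m%:R^-1)%:E) ->
  (* rho_i : continuous hash value with Pr[rho_i > t] = 2^{-t} for real t >= 0 *)
  (forall i, measurable_fun setT (rho i)) ->
  (forall i (t : R), 0 <= t -> P [set w | t < rho i w] = (2 `^ (- t))%:E) ->
  hll_indep P f rho ->
  let B : R := log2 (n%:R / m%:R) in
  let Delta : R := 2 + log2 (log2 (m%:R : R)) in
  ((1 - expR (- (m%:R / (6 * log2 (m%:R : R)))))%:E
     <= P [set w | (m%:R - m%:R / log2 (m%:R : R) <=
            #|[set j : 'I_m | (B - Delta < hll_register f rho j w)
                              && (hll_register f rho j w < B + Delta)]%SET|%:R)%R])%E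
  /\
  (* hence such values can be encoded with ceil(log2 Delta) + 1 bits: the number of
     (integer) register values in (B - Delta, B + Delta) is at most 2^(ceil(log2 Delta)+1) *)
  (forall s : seq int, uniq s ->
     all (fun k : int => (B - Delta < k%:~R) && (k%:~R < B + Delta)) s ->
     (size s)%:R <= (2 : R) ^ (Num.ceil (log2 Delta) + 1)).
Proof.
move=> m2 nbig mf Pf mrho Prho ind B Delta.
have m0 : (0 < m)%N by exact: leq_trans m2.
have m0R : 0 < m%:R :> R by rewrite ltr0n.
have L1 : 1 <= log2 m%:R :> R
  by rewrite -[X in X <= _](log2_2 R) ler_log2 ?ler_nat.
move: (log2 m%:R) L1 @Delta nbig => L L1 Delta nbig.
have L4 : 0 < 4 * L by lra.
have n0R : 0 < n%:R :> R by apply: lt_trans nbig; rewrite mulrAC mulr_gt0.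
have powDelta : 2 `^ Delta = 4 * L.
  by rewrite powRD ?pnatr_eq0 ?implybT // powR_log2 ?powR_mulrn ?expr2; lra.
have powB : 2 `^ B = n%:R / m%:R by rewrite powR_log2 // divr_gt0.
have Delta2 : 2 <= Delta by rewrite lerDl log2_ge0.
(* This is where [4 m L < n] enters; it puts [lo] in the range of the tail law. *)
have lo0 : 0 <= B - Delta.
  rewrite subr_ge0 -[Delta]log2_powR2 powDelta ler_log2 //.
  by rewrite ler_pdivlMr // ltW // mulrAC.
have hi2 : 1 / 2 <= B + Delta by move: lo0 Delta2; clear; lra.
split; last by move=> s; apply: size_int_centered_itv; move: Delta2; clear; lra.
have powlo : 2 `^ (- (B - Delta)) = 4 * L * m%:R / n%:R.
  by rewrite opprB powRD ?pnatr_eq0 ?implybT // powRN powDelta powB invf_div mulrA.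
have powhi : 2 `^ (- (B + Delta)) = m%:R / n%:R / (4 * L).
  rewrite opprD powRD ?pnatr_eq0 ?implybT // (powRN _ B) (powRN _ Delta).
  by rewrite powDelta powB invf_div.
(* Here [a = 4 L m / n], [b = sqrt 2 * m / (4 L n)] and [t = m / L], so that [n a / m = 4 L] and
   [n b = m sqrt 2 / (4 L)]. *)
apply: le_trans (prob_hll_register_centered _ _ _ _ _ _ _ _ _ _ _ _ _ m0 mf Pf mrho ind
  lo0 (lt_le_trans _ hi2) (fun i => Prho i _ lo0)
  (fun i => prob_ge_le_sqrt2 _ _ _ _ _ _ (mrho i) (Prho i) hi2)); last by lra.
rewrite lee_fin lerD2l lerN2 powlo powhi.
apply: le_trans (hll_tail_exponent _ _ _ m0R L1).
rewrite (_ : n%:R * (4 * L * m%:R / n%:R) / m%:R = 4 * L); last first.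
  by field; rewrite !gt_eqF.
rewrite (_ : n%:R * (Num.sqrt 2 * (m%:R / n%:R / (4 * L))) = m%:R * Num.sqrt 2 / (4 * L)) //.
by field; rewrite !gt_eqF // -(pmulr_rgt0 _ (ltr0n R 4)).
Qed.
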